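(* Let $n\ge5$. The $\widetilde{\mathscr{L}}$-classes of $\mathcal{E}_n=\mathrm{End}(\mathcal{T}_n)$ are $\mathcal{E}_n\setminus(E_3\cup E_2\cup E_1)$ and all the singletons $\{\eta\}$ where $\eta=\eta^2\ne\varepsilon$.
   Context: Maps are written on the right and composed left to right. $\mathcal{T}_n$ is the full transformation semigroup of all maps $\{1,\dots,n\}\to\{1,\dots,n\}$; $\mathcal{S}_n$, $\mathcal{A}_n$ are the symmetric and alternating groups, $\mathrm{id}$ the identity map. $\mathcal{E}_n=\mathrm{End}(\mathcal{T}_n)$ is the monoid of all semigroup endomorphisms of $\mathcal{T}_n$ (not required to fix $\mathrm{id}$), with identity $\varepsilon$, and $\mathcal{G}_n=\mathrm{Aut}(\mathcal{T}_n)$. For $g\in\mathcal{S}_n$, $\psi_g:s\mapsto g^{-1}sg$. For $t,e\in\mathcal{T}_n$, $\phi_{t,e}$ sends $s\mapsto t$ if $s\in\mathcal{S}_n\setminus\mathcal{A}_n$, $s\mapsto t^2$ if $s\in\mathcal{A}_n$, $s\mapsto e$ if $s\in\mathcal{T}_n\setminus\mathcal{S}_n$. By a known theorem of Schein and Teclezghi, $\mathcal{G}_n=\{\psi_g:g\in\mathcal{S}_n\}$ and, for $n\neq4$, $\mathcal{E}_n=\mathcal{G}_n\cup\{\phi_{t,e}: t^3=t,\ te=et=e^2=e\}$. Define $E_3=\{\phi_{t,e}\in\mathcal{E}_n: t\in\mathcal{S}_n\setminus\mathcal{A}_n,\ e\ne\mathrm{id}\}$, $E_2=\{\phi_{\mathrm{id},e}\in\mathcal{E}_n: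 e\neq\mathrm{id}\}$, $E_1=\{\phi_{e,e}\in\mathcal{E}_n\}$; the set of idempotents of $\mathcal{E}_n$ is $\{\varepsilon\}\cup E_3\cup E_2\cup E_1$. The relation $\widetilde{\mathscr{L}}$ on $\mathcal{E}_n$: $\alpha\mathrel{\widetilde{\mathscr{L}}}\beta$ iff for all idempotents $\eta\in\mathcal{E}_n$, $\alpha\eta=\alpha\Leftrightarrow\beta\eta=\beta$. *)

(* Defs.v *)
From HB Require Import structures.
From mathcomp Require Import all_boot all_fingroup all_solvable.

Set Implicit Arguments.
Unset Strict Implicit.
Unset Printing Implicit Defensive.

Import GroupScope.
Local Open Scope group_scope.

(* The full transformation semigroup.  Its points are 0, ..., n-1 instead of
   1, ..., n, and products are read left to right, as for permutations. *)
Definition trans (n : nat) : Type := {ffun 'I_n -> 'I_n}.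

HB.instance Definition _ (n : nat) := Finite.on (trans n).

Section TransMonoid.

Variable n : nat.
Implicit Types s t : trans n.

Definition trans_mul s t : trans n := [ffun i => t (s i)].
Definition trans_one : trans n := [ffun i => i].

Fact trans_mulA : associative trans_mul.
Proof. by move=> s t u; apply/ffunP=> i; rewrite !ffunE. Qed.

Fact trans_mul1 : left_id trans_one trans_mul.
Proof. by move=> s; apply/ffunP=> i; rewrite !ffunE. Qed.

Fact trans_mulr1 : right_id trans_one trans_mul.
Proof. by move=> s; apply/ffunP=> i; rewrite !ffunE. Qed.

HB.instance Definition _ :=
  isMonoid.Build (trans n) trans_mulA trans_mul1 trans_mulr1.

End TransMonoid.

Definition trans_of_perm (n : nat) (p : 'S_n) : trans n := [ffun i => p i].

Definition symT (n : nat) : {set trans n} :=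
  [set trans_of_perm p | p in 'Sym_('I_n)].

Definition altT (n : nat) : {set trans n} :=
  [set trans_of_perm p | p in 'Alt_('I_n)].

(* Semigroup endomorphisms: preservation of 1 is not required. *)
Definition endo_mult (n : nat) (f : {ffun trans n -> trans n}) : bool :=
  [forall s : trans n, forall t : trans n, f (s * t) == f s * f t].

Record endo (n : nat) : Type := Endo {
  endo_fun :> {ffun trans n -> trans n};
  endo_multP : endo_mult endo_fun }.

HB.instance Definition _ (n : nat) := [isSub for @endo_fun n].
HB.instance Definition _ (n : nat) := [Finite of endo n by <:].

Section EndoMonoid.

Variable n : nat.
Implicit Types a b : endo n.

Fact endoM a : {morph a : s t / s * t}.
Proof. by move=> s t; have /forallP/(_ s)/forallP/(_ t)/eqP := endo_multP a. Qed.

HB.instance Definition _ a := isMultiplicative.Build (trans n) (trans n) a (endoM a).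

Fact endo_mul_subproof a b : endo_mult [ffun s => b (a s)].
Proof. by apply/forallP=> s; apply/forallP=> t; rewrite !ffunE !endoM. Qed.

Definition endo_mul a b : endo n := Endo (endo_mul_subproof a b).

Fact endo_one_subproof : endo_mult [ffun s : trans n => s].
Proof. by apply/forallP=> s; apply/forallP=> t; rewrite !ffunE. Qed.

Definition endo_one : endo n := Endo endo_one_subproof.

Fact endo_mulA : associative endo_mul.
Proof. by move=> a b c; apply/val_inj/ffunP=> s; rewrite !ffunE. Qed.

Fact endo_mul1 : left_id endo_one endo_mul.
Proof. by move=> a; apply/val_inj/ffunP=> s; rewrite !ffunE. Qed.

Fact endo_mulr1 : right_id endo_one endo_mul.
Proof. by move=> a; apply/val_inj/ffunP=> s; rewrite !ffunE. Qed.

HB.instance Definition _ :=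
  isMonoid.Build (endo n) endo_mulA endo_mul1 endo_mulr1.

End EndoMonoid.

(* A map that need not be an endomorphism: the sets E3, E2 and E1 below keep
   only the pairs (t, e) for which it is one. *)
Definition phi (n : nat) (t e : trans n) : {ffun trans n -> trans n} :=
  [ffun s => if s \in altT n then t ^+ 2
             else if s \in symT n then t else e].

Definition E3 (n : nat) : {set endo n} :=
  [set a : endo n | val a \in
     [set phi t e | t in symT n :\: altT n, e in [set~ (1 : trans n)]]].

Definition E2 (n : nat) : {set endo n} :=
  [set a : endo n | val a \in [set phi 1 e | e in [set~ (1 : trans n)]]].

Definition E1 (n : nat) : {set endo n} :=
  [set a : endo n | val a \in [set phi e e | e : trans n]].

Definition idempotents (n : nat) : {set endo n} :=
  [set eta : endo n | eta * eta == eta].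

Definition Ltilde (n : nat) (a b : endo n) : bool :=
  [forall eta in idempotents n, (a * eta == a) == (b * eta == b)].

Fact Ltilde_equiv (n : nat) : equivalence_rel (@Ltilde n).
Proof.
move=> a b c; split=> [|/forall_inP ab]; first by apply/forall_inP.
by apply/forall_inP/forall_inP=> h eta idem; have := h eta idem;
   rewrite (eqP (ab eta idem)).
Qed.

Definition Ltilde_classes (n : nat) : {set {set endo n}} :=
  equivalence_partition (@Ltilde n) [set: endo n].

(* Main.v *)
Require Import Defs.
From mathcomp Require Import all_boot all_fingroup all_solvable.

(** Write [e] for the value of an endomorphism [a] on the constant maps, when
    there is only one.  Since constants are right zeros, [e] is then a two-sided
    zero of the image of [a].

    The heart of the matter is that every non-injective endomorphism is some
    [phi t e] ([noninj_phi]).  By double transitivity [a] is either injective or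
    constant on the constant maps, and in the first case it is injective
    altogether.  In the second case the points in the image of [e] are fixed by
    the whole image of [a], so that [A_n] acts on the image of the idempotent
    [a 1] with a fixed point.  Such an action cannot be faithful for reasons of
    cardinality, and [A_n] is simple, hence [A_n] acts trivially
    ([noninj_alt]).  All the rank [n - 1] idempotents are conjugate under [A_n],
    so they have a common image; products of them reach the constants, so this
    image is [e], and every non-permutation is sent to [e] because it is
    absorbed by one of these idempotents.

    Suppose now that [a * eta = a] with [eta] a non-identity idempotent.  Both
    maps are non-injective, say [a = phi t e] and [eta = phi u f], and [eta]
    fixes [t] and [e].  Going through the possible positions of [t] (odd, even,
    singular) shows that [a] lies in [E3], [E2] or [E1] ([fixed_nonid_idem]).
    With [a = eta] this identifies the non-identity idempotents; for the other
    [a] it says that the identity is the only idempotent right unit, so that all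
    of them are related.  Finally, two related non-identity idempotents are
    right units of each other, hence have the same image [{t, t^2, e}], and the
    identity and the zero of this set determine the idempotent
    ([nonid_idem_fix_eq]). *)

Section EndomorphismsOfTn.

Set Implicit Arguments.
Unset Strict Implicit.
Unset Printing Implicit Defensive.

Import GroupScope.
Local Open Scope group_scope.

Variable n : nat.
Implicit Types (s t e : trans n) (p q : 'S_n) (a b eta : endo n).

(** * Permutations, constants and rank [n - 1] idempotents *)

Lemma trans_mulE s t i : (s * t) i = t (s i).
Proof. by rewrite ffunE. Qed.

Lemma trans_oneE i : (1 : trans n) i = i.
Proof. by rewrite ffunE. Qed.

Lemma trans_of_permE p i : trans_of_perm p i = p i.
Proof. by rewrite ffunE. Qed.

Lemma trans_of_permM p q :
  trans_of_perm (p * q) = trans_of_perm p * trans_of_perm q.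
Proof. by apply/ffunP=> i; rewrite trans_mulE !trans_of_permE permM. Qed.

Lemma trans_of_perm1 : trans_of_perm 1 = 1 :> trans n.
Proof. by apply/ffunP=> i; rewrite trans_of_permE trans_oneE perm1. Qed.

Lemma trans_of_perm_inj : injective (@trans_of_perm n).
Proof.
by move=> p q /ffunP eq_pq; apply/permP=> i; rewrite -!trans_of_permE eq_pq.
Qed.

Lemma symT_perm p : trans_of_perm p \in symT n.
Proof. by apply: imset_f; rewrite inE. Qed.

Lemma symTP s : reflect (exists p, s = trans_of_perm p) (s \in symT n).
Proof.
apply: (iffP imsetP) => [[p _ ->]|[p ->]]; first by exists p.
by exists p; rewrite // inE.
Qed.

Lemma altT_perm p : (trans_of_perm p \in altT n) = ~~ odd_perm p.
Proof. by rewrite (mem_imset _ _ trans_of_perm_inj) Alt_even. Qed.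

Lemma altT_symT s : s \in altT n -> s \in symT n.
Proof. by case/imsetP=> p _ ->; apply: symT_perm. Qed.

Lemma one_altT : (1 : trans n) \in altT n.
Proof. by rewrite -trans_of_perm1 altT_perm odd_perm1. Qed.

Lemma symT_inj s : (s \in symT n) = injectiveb s.
Proof.
apply/symTP/injectiveP => [[p ->] i j|s_inj].
  by rewrite !trans_of_permE; apply: perm_inj.
by exists (perm s_inj); apply/ffunP=> i; rewrite trans_of_permE permE.
Qed.

Lemma symT_idem s : s \in symT n -> s * s = s -> s = 1.
Proof.
rewrite symT_inj => /injectiveP s_inj /ffunP ss; apply/ffunP=> i.
by apply: s_inj; rewrite -trans_mulE ss trans_oneE.
Qed.

Definition const_trans i : trans n := [ffun=> i].

Lemma mul_trans_const s i : s * const_trans i = const_trans i.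
Proof. by apply/ffunP=> j; rewrite trans_mulE !ffunE. Qed.

Lemma mul_const_trans s i : const_trans i * s = const_trans (s i).
Proof. by apply/ffunP=> j; rewrite trans_mulE !ffunE. Qed.

Definition merge i j : trans n := [ffun k => if k == i then j else k].

Lemma merge_idem i j : merge i j * merge i j = merge i j.
Proof.
apply/ffunP=> k; rewrite trans_mulE !ffunE.
by case: (k =P i) => [_|/eqP/negbTE->]; rewrite ?if_same //; case: eqP.
Qed.

Lemma mergeii i : merge i i = 1.
Proof. by apply/ffunP=> k; rewrite !ffunE; case: eqP. Qed.

Lemma mergeJ i j p :
  trans_of_perm p^-1 * merge i j * trans_of_perm p = merge (p i) (p j).
Proof.
apply/ffunP=> k; rewrite !trans_mulE !ffunE -(canF_eq (permKV p)).
by case: eqP; rewrite ?permKV.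
Qed.

Lemma nonperm_merge s :
  s \notin symT n -> exists i j, i != j /\ merge i j * s = s.
Proof.
rewrite symT_inj => /injectivePn[i [j neq_ij s_ij]]; exists i, j; split=> //.
by apply/ffunP=> k; rewrite trans_mulE ffunE; case: eqP => // ->.
Qed.

Hypothesis n_ge5 : 5 <= n.

Lemma fresh_point (A : {set 'I_n}) : #|A| < n -> exists i, i \notin A.
Proof.
move=> ltA; have /card_gt0P[i] : 0 < #|~: A|.
  by rewrite -(ltn_add2l #|A|) addn0 cardsC card_ord.
by rewrite inE; exists i.
Qed.

(** A permutation with the right two values can be made even by a transposition
    of two points away from [k] and [l]. *)
Lemma Alt_2trans (i j k l : 'I_n) : i != j -> k != l ->
  exists p : 'S_n, [/\ ~~ odd_perm p, p i = k & p j = l].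
Proof.
move=> neq_ij neq_kl.
(* [tperm i k] moves [j] to some point other than [k], so that the second
   transposition leaves [k] alone. *)
pose p := tperm i k * tperm (tperm i k j) l.
have pi : p i = k.
  rewrite permM tpermL tpermD // 1?eq_sym //.
  by rewrite -{1}(tpermL i k) (inj_eq perm_inj).
have pj : p j = l by rewrite permM tpermL.
case odd_p: (odd_perm p); last by exists p; rewrite odd_p.
have [x] : exists x, x \notin [set k; l].
  by apply: fresh_point; rewrite cards2 neq_kl (leq_trans _ n_ge5).
rewrite !inE negb_or => /andP[neq_xk neq_xl].
have [y] : exists y, y \notin [set x; k; l].
  apply: fresh_point; apply: leq_ltn_trans (_ : 3 < n); last exact: ltnW.
  by rewrite (leq_trans (leq_card_setU _ _)) // cards2 cards1 addn1; case: eqP.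
rewrite !inE !negb_or -andbA => /and3P[neq_yx neq_yk neq_yl].
exists (p * tperm x y); rewrite odd_permM odd_p odd_tperm eq_sym neq_yx.
by rewrite !(permM p) pi pj !tpermD.
Qed.

Lemma odd_exists : exists p : 'S_n, odd_perm p.
Proof.
have n_gt0 : 0 < n by apply: leq_trans n_ge5.
have n_gt1 : 1 < n by apply: leq_trans n_ge5.
by exists (tperm (Ordinal n_gt0) (Ordinal n_gt1)); rewrite odd_tperm.
Qed.

Lemma point_exists : exists i : 'I_n, true.
Proof. by exists (Ordinal (leq_trans (isT : 0 < 5) n_ge5)). Qed.

Lemma const_nonperm i : const_trans i \notin symT n.
Proof.
rewrite symT_inj; apply/negP=> /injectiveP const_inj.
have [j] : exists j, j \notin [set i].
  by apply: fresh_point; rewrite cards1 (leq_trans _ n_ge5).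
by rewrite inE => /eqP[]; apply: const_inj; rewrite !ffunE.
Qed.

(** * Non-injective endomorphisms *)

Lemma phi_nonperm t e s : s \notin symT n -> phi t e s = e.
Proof.
by move=> s_np; rewrite ffunE (contraNF (@altT_symT s) s_np) (negbTE s_np).
Qed.

Lemma phi_alt t e s : s \in altT n -> phi t e s = t ^+ 2.
Proof. by rewrite ffunE => ->. Qed.

Lemma phi_odd t e s : s \in symT n :\: altT n -> phi t e s = t.
Proof. by rewrite ffunE inE => /andP[/negbTE-> ->]. Qed.

(** A map [s] is recovered from its products [const_trans i * s], which are
    again constants. *)
Lemma endo_inj_on_const a :
  {in codom const_trans &, injective a} -> injective a.
Proof.
move=> a_inj s t eq_st; apply/ffunP=> i.
have: a (const_trans (s i)) = a (const_trans (t i)).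
  by rewrite -!mul_const_trans !endoM eq_st.
by move/(a_inj _ _ (codom_f _ _) (codom_f _ _))/ffunP/(_ i); rewrite !ffunE.
Qed.

(** If two distinct constants had different images, so would any other two,
    as some permutation carries the one pair to the other. *)
Lemma noninj_const a i j :
  ~~ injectiveb a -> a (const_trans i) = a (const_trans j).
Proof.
have [->//|neq_ij] := eqVneq i j.
move=> a_ninj; apply/eqP; move: a_ninj; apply: contraR => neq_a.
apply/injectiveP/endo_inj_on_const => _ _ /codomP[k ->] /codomP[l ->].
have [->//|neq_kl eq_a] := eqVneq k l; case/eqP: neq_a.
have [p [_ pk pl]] := Alt_2trans neq_kl neq_ij.
by rewrite -pk -pl -!trans_of_permE -!mul_const_trans !endoM eq_a.
Qed.

Lemma noninj_zero a i s : ~~ injectiveb a ->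
  a s * a (const_trans i) = a (const_trans i)
  /\ a (const_trans i) * a s = a (const_trans i).
Proof.
move=> a_ninj; rewrite -!endoM mul_trans_const mul_const_trans.
by split=> //; apply: noninj_const.
Qed.

(** The action of [S_n] through [a] on the image of the idempotent [a 1],
    extended by the identity outside it so that it becomes a genuine group
    homomorphism into [S_n]. *)
Definition act_fun a p : trans n :=
  [ffun i => if a 1 i == i then a (trans_of_perm p) i else i].

Lemma endo1_image a s i : a 1 (a s i) = a s i.
Proof. by rewrite -trans_mulE -endoM mulg1. Qed.

Lemma endo_1_image a s i : a s (a 1 i) = a s i.
Proof. by rewrite -trans_mulE -endoM mul1g. Qed.

Lemma act_funM a p q : act_fun a (p * q) = act_fun a p * act_fun a q.
Proof.
apply/ffunP=> i; rewrite trans_mulE !ffunE trans_of_permM endoM trans_mulE.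
by case: ifP => [_|->//]; rewrite endo1_image eqxx.
Qed.

Lemma act_fun1 a : act_fun a 1 = 1.
Proof.
by apply/ffunP=> i; rewrite !ffunE trans_of_perm1; case: eqP => [->|].
Qed.

Lemma act_fun_inj a p : injective (act_fun a p).
Proof.
apply: (can_inj (g := act_fun a p^-1)) => i.
by rewrite -trans_mulE -act_funM mulgV act_fun1 trans_oneE.
Qed.

Definition act_perm a p : 'S_n := perm (@act_fun_inj a p).

Lemma act_permM a : {in [set: 'S_n] &, {morph act_perm a : p q / p * q}}.
Proof.
by move=> p q _ _; apply/permP=> i; rewrite permM !permE act_funM trans_mulE.
Qed.

Canonical act_morphism a := Morphism (act_permM a).

(** The common value of [a] on constants absorbs every [a s] on the right, so
    the points in its image are fixed by all of them. *)
Lemma act_perm_fix a i p :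
  ~~ injectiveb a -> act_perm a p (a (const_trans i) i) = a (const_trans i) i.
Proof.
move=> a_ninj; rewrite permE ffunE -!trans_mulE.
by rewrite !(noninj_zero i _ a_ninj).2 eqxx.
Qed.

(** A faithful action of [A_n] with a fixed point would embed a group of order
    [n! / 2] into one of order [(n - 1)!]; so simplicity of [A_n] makes the
    action trivial. *)
Lemma noninj_alt a p :
  ~~ injectiveb a -> ~~ odd_perm p -> a (trans_of_perm p) = a 1.
Proof.
move=> a_ninj even_p.
have AltS : 'Alt_('I_n) \subset [set: 'S_n] by apply: subsetT.
pose K := 'ker_('Alt_('I_n)) (act_morphism a).
have nsK : K <| 'Alt_('I_n).
  rewrite /normal subsetIl normsI ?normG //.
  by apply: subset_trans AltS _; apply: ker_norm.
have [_ /(_ [group of K] nsK)] :=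
  simpleP _ (@simple_Alt5 'I_n (leq_trans n_ge5 (eq_leq (esym (card_ord n))))).
case=> [/= K1 | KA]; last first.
  have: p \in K by rewrite [K]KA Alt_even.
  rewrite inE => /andP[_ /mker /permP act1].
  (* The action only sees the image of [a 1], but [a 1 * a s = a s]. *)
  apply/ffunP=> i; have := act1 (a 1 i).
  by rewrite permE ffunE endo1_image eqxx perm1 endo_1_image.
exfalso.
have [i0 _] := point_exists; pose x0 := a (const_trans i0) i0.
have inj_act : 'injm (restrm AltS (act_morphism a)).
  by rewrite ker_restrm; apply/trivgP.
have: #|'Alt_('I_n)| <= n.-1`!.
  have <- : #|~: [set x0]| = n.-1 by rewrite cardsC1 card_ord.
  rewrite -card_perm -(card_injm inj_act) //; apply/subset_leq_card/subsetP.
  move=> _ /morphimP[q _ _ ->]; apply/subsetP=> i.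
  rewrite !inE; apply: contraNneq => ->; apply/eqP.
  exact: act_perm_fix.
have n_gt1 : 1 < n by apply: leq_trans n_ge5.
have := @card_Alt 'I_n; rewrite card_ord => /(_ n_gt1).
case: n n_ge5 => // m m_ge4 /=; rewrite factS => card_m le_m.
have: m.+1 * m`! <= 2 * m`! by rewrite -card_m leq_mul2l.
by rewrite leq_pmul2r ?fact_gt0 // ltnNge (leq_trans (isT : 2 <= 4) m_ge4).
Qed.

Lemma noninj_merge a i j k l : ~~ injectiveb a -> i != j -> k != l ->
  a (merge i j) = a (merge k l).
Proof.
move=> a_ninj neq_ij neq_kl.
have [p [even_p <- <-]] := Alt_2trans neq_ij neq_kl.
rewrite -mergeJ !endoM !noninj_alt ?odd_permV //.
by rewrite -!endoM mul1g mulg1.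
Qed.

(** The constant map to [k] is the product of the [merge x k] over all [x], and
    each factor is absorbed by the idempotent [a (merge i j)]. *)
Lemma noninj_merge_const a i j k : ~~ injectiveb a -> i != j ->
  a (merge i j) = a (const_trans k).
Proof.
move=> a_ninj neq_ij.
have absorb (r : seq 'I_n) :
    a (merge i j) * a [ffun l => if l \in r then k else l] = a (merge i j).
  elim: r => [|x r IHr].
    have -> : [ffun l => if l \in [::] then k else l] = 1 :> trans n.
      by apply/ffunP=> l; rewrite !ffunE.
    by rewrite -endoM mulg1.
  have -> : [ffun l => if l \in x :: r then k else l]
            = merge x k * [ffun l => if l \in r then k else l] :> trans n.
    apply/ffunP=> l; rewrite trans_mulE !ffunE inE.
    by case: (l =P x) => //= _; rewrite if_same.
  rewrite endoM mulgA -endoM.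
  have [->|neq_xk] := eqVneq x k; first by rewrite mergeii mulg1.
  by rewrite endoM (noninj_merge a_ninj neq_xk neq_ij) -endoM merge_idem.
rewrite -(absorb (enum 'I_n)).
have -> : [ffun l => if l \in enum 'I_n then k else l] = const_trans k.
  by apply/ffunP=> l; rewrite !ffunE mem_enum.
by rewrite (noninj_zero _ _ a_ninj).1.
Qed.

(** A non-permutation identifies two points [i] and [j], hence absorbs
    [merge i j], which [a] sends to the zero of its image. *)
Lemma noninj_nonperm a s k :
  ~~ injectiveb a -> s \notin symT n -> a s = a (const_trans k).
Proof.
move=> a_ninj /nonperm_merge[i [j [neq_ij <-]]].
rewrite endoM (noninj_merge_const k a_ninj neq_ij).
by rewrite (noninj_zero _ _ a_ninj).2.
Qed.

(** [A_n] goes to the idempotent [a 1], so all odd permutations have the same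
    image [t], with [t ^+ 2 = a 1]. *)
Lemma noninj_phi a : ~~ injectiveb a -> exists t e, val a = phi t e.
Proof.
move=> a_ninj; have [q odd_q] := odd_exists; have [i _] := point_exists.
exists (a (trans_of_perm q)), (a (const_trans i)); apply/ffunP=> s.
have [/symTP[p ->]|s_np] := boolP (s \in symT n); last first.
  by rewrite phi_nonperm //; apply: noninj_nonperm.
have [odd_p|even_p] := boolP (odd_perm p); last first.
  rewrite phi_alt ?altT_perm // expg2 -endoM -trans_of_permM.
  by rewrite !noninj_alt // odd_permM addbb.
rewrite phi_odd ?inE ?symT_perm ?altT_perm ?odd_p //.
have -> : p = (p * q^-1) * q by rewrite mulgKV.
rewrite trans_of_permM endoM (@noninj_alt _ (p * q^-1)) //.
  by rewrite -endoM mul1g.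
by rewrite odd_permM odd_permV odd_p odd_q.
Qed.

(** * Idempotents and the relation [Ltilde] *)

Lemma endo_mulE a b s : (a * b) s = b (a s).
Proof. by rewrite ffunE. Qed.

Lemma endo_oneE s : (1 : endo n) s = s.
Proof. by rewrite ffunE. Qed.

Lemma eq_endo a b : (forall s, a s = b s) -> a = b.
Proof. by move=> eq_ab; apply/val_inj/ffunP. Qed.

(** That these are exactly the non-identity idempotents is [nonid_idemE]. *)
Definition nonid_idem : {set endo n} := E3 n :|: E2 n :|: E1 n.

Lemma nonid_idemP a : reflect
  (exists t e, val a = phi t e /\
     [\/ t \in symT n :\: altT n /\ e != 1, t = 1 /\ e != 1 | t = e])
  (a \in nonid_idem).
Proof.
apply: (iffP idP).
  rewrite !inE -orbA => /or3P[/imset2P[t e ht]|/imsetP[e]|/imsetP[e _]].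
  - by rewrite !inE => he def_a; exists t, e; split=> //; apply: Or31.
  - by rewrite !inE => he def_a; exists 1, e; split=> //; apply: Or32.
  - by move=> def_a; exists e, e; split=> //; apply: Or33.
case=> t [e [def_a [[ht he]|[t1 he]|te]]]; rewrite !inE def_a.
- by rewrite (imset2_f _ ht) // !inE.
- by rewrite t1 (imset_f (phi 1)) ?orbT // !inE.
- by rewrite te (imset_f (fun x => phi x x)) ?orbT // !inE.
Qed.

Section PhiEndo.

Variables (a : endo n) (t e : trans n).
Hypothesis def_a : val a = phi t e.

Lemma endo_phiE s : a s = phi t e s.
Proof. by rewrite -def_a. Qed.

Lemma phi_noninj : ~~ injectiveb a.
Proof.
apply/injectiveP=> a_inj; have [i _] := point_exists.
have [j] : exists j, j \notin [set i].
  by apply: fresh_point; rewrite cards1 (leq_trans _ n_ge5).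
rewrite inE => /eqP neq_ji; apply: neq_ji.
have /a_inj/ffunP/(_ i) : a (const_trans j) = a (const_trans i).
  by rewrite !endo_phiE !phi_nonperm ?const_nonperm.
by rewrite !ffunE.
Qed.

Lemma phi_value_odd : exists s, s \in symT n :\: altT n /\ a s = t.
Proof.
have [p odd_p] := odd_exists; exists (trans_of_perm p).
have hp : trans_of_perm p \in symT n :\: altT n.
  by rewrite inE symT_perm altT_perm odd_p.
by rewrite endo_phiE phi_odd.
Qed.

Lemma phi_value_nonperm : exists i, a (const_trans i) = e.
Proof.
have [i _] := point_exists; exists i.
by rewrite endo_phiE phi_nonperm ?const_nonperm.
Qed.

Lemma phi_e_idem : e * e = e.
Proof.
by have [i <-] := phi_value_nonperm; rewrite -endoM mul_trans_const.
Qed.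

Lemma phi_te : t * e = e.
Proof.
have [i <-] := phi_value_nonperm; have [s [_ <-]] := phi_value_odd.
by rewrite -endoM mul_trans_const.
Qed.

Lemma phi_one : a 1 = t ^+ 2.
Proof. by rewrite endo_phiE phi_alt ?one_altT. Qed.

Lemma phi_e_perm : e \in symT n -> e = 1.
Proof. by move=> e_perm; apply: symT_idem phi_e_idem. Qed.

Lemma phi_e1 : e = 1 -> t = 1.
Proof. by have := phi_te => /[swap] ->; rewrite mulg1. Qed.

Lemma phi_cases s : [\/ a s = t, a s = t ^+ 2 | a s = e].
Proof.
rewrite endo_phiE ffunE; case: ifP => _; first exact: Or32.
by case: ifP => _; [apply: Or31 | apply: Or33].
Qed.

End PhiEndo.

Lemma endo1_idem a : a 1 * a 1 = a 1.
Proof. by rewrite -endoM mulg1. Qed.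

(** If [a] were injective, it would be onto by finiteness, and [eta] would fix
    everything. *)
Lemma fixed_noninj a eta : eta != 1 -> a * eta = a -> ~~ injectiveb a.
Proof.
move=> eta_n1 fix_a; apply/injectiveP=> a_inj; case/eqP: eta_n1.
apply: eq_endo => s; have [a' _ aK] := injF_bij a_inj.
by rewrite -(aK s) -endo_mulE fix_a endo_oneE.
Qed.

(** Write [a = phi t e] and [eta = phi u f], where [eta] fixes [t] and [e].  If
    [t] is singular, then [t = eta t = f], and likewise [e = f], as a
    permutation [e] would force [e = 1] and [t = t * e = 1].  If [t] is even,
    then [t = eta t = eta 1] is an idempotent permutation, so [t = 1].  If [t]
    is odd, then [e] cannot be [1], because [t * e = e]. *)
Lemma fixed_nonid_idem a eta :
  ~~ injectiveb a -> ~~ injectiveb eta -> a * eta = a -> a \in nonid_idem.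
Proof.
move=> /noninj_phi[t [e def_a]] /noninj_phi[u [f def_eta]] fix_a.
have fixed s : eta (a s) = a s by rewrite -endo_mulE fix_a.
have eta_t : eta t = t by have [s [_ <-]] := phi_value_odd def_a.
have eta_e : eta e = e by have [i <-] := phi_value_nonperm def_a.
apply/nonid_idemP; exists t, e; split=> //.
have [t_perm|t_np] := boolP (t \in symT n); last first.
  have def_t : f = t by rewrite -[RHS]eta_t (endo_phiE def_eta) phi_nonperm.
  have [e_perm|e_np] := boolP (e \in symT n).
    have e1 := phi_e_perm def_a e_perm.
    by rewrite (phi_e1 def_a e1) altT_symT ?one_altT in t_np.
  apply: Or33; rewrite -def_t -eta_e.
  by rewrite (endo_phiE def_eta) phi_nonperm.
have [t_alt|t_odd] := boolP (t \in altT n).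
  have t1 : t = 1.
    apply: symT_idem => //; suff -> : t = eta 1 by apply: endo1_idem.
    by rewrite (phi_one def_eta) -[LHS]eta_t (endo_phiE def_eta) phi_alt.
  have [->|e_n1] := eqVneq e 1; first exact: Or33.
  exact: Or32.
apply: Or31; rewrite inE t_odd t_perm; split=> //.
by apply: contraNneq t_odd => /(phi_e1 def_a) ->; apply: one_altT.
Qed.

(** It suffices that [a] fixes its values [t] and [e], because the third one is
    [t ^+ 2]. *)
Lemma nonid_idem_mulgg a : a \in nonid_idem -> a * a = a.
Proof.
case/nonid_idemP=> t [e [def_a hte]].
have aE := endo_phiE def_a; have ee := phi_e_idem def_a.
suff [at_ ae] : a t = t /\ a e = e.
  apply: eq_endo => s; rewrite endo_mulE.
  by have [->|->|->] := phi_cases def_a s; rewrite // expg2 endoM at_.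
have a_e : e != 1 -> a e = e.
  move=> e_n1; rewrite aE phi_nonperm //.
  by apply: contra e_n1 => /(phi_e_perm def_a)->.
case: hte => [[t_odd e_n1]|[t1 e_n1]|te].
- by rewrite a_e // aE phi_odd.
- by rewrite a_e // t1 (phi_one def_a) t1 expg2 mulg1.
rewrite te; suff -> : a e = e by [].
have [e1|/a_e //] := eqVneq e 1.
by rewrite e1 (phi_one def_a) te e1 expg2 mulg1.
Qed.

Lemma nonid_idem_noninj a : a \in nonid_idem -> ~~ injectiveb a.
Proof. by case/nonid_idemP=> t [e [/phi_noninj]]. Qed.

Lemma nonid_idem_n1 a : a \in nonid_idem -> a != 1.
Proof.
move/nonid_idem_noninj; apply: contraNneq => ->.
by apply/injectiveP=> s t; rewrite !endo_oneE.
Qed.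

Lemma nonid_idemE a : (a \in nonid_idem) = (a \in idempotents n) && (a != 1).
Proof.
apply/idP/andP => [Ea | [a_idem a_n1]].
  by rewrite inE nonid_idem_mulgg ?eqxx ?nonid_idem_n1.
have idem_a : a * a = a by apply/eqP; move: a_idem; rewrite inE.
have a_ninj := fixed_noninj a_n1 idem_a.
exact: (fixed_nonid_idem a_ninj a_ninj idem_a).
Qed.

(** The hypotheses say that [a] and [b] have the same image.  This set has one
    zero and one identity, so [e = f] and [t ^+ 2 = u ^+ 2]; as [t] and [u] are
    both among its at most three elements, they agree as well. *)
Lemma nonid_idem_fix_eq a b :
  a \in nonid_idem -> b \in nonid_idem -> a * b = a -> b * a = b -> a = b.
Proof.
case/nonid_idemP=> t [e [def_a _]] /nonid_idemP[u [f [def_b _]]] ab ba.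
have fix_b s : b (a s) = a s by rewrite -endo_mulE ab.
have fix_a s : a (b s) = b s by rewrite -endo_mulE ba.
have [s [_ as_]] := phi_value_odd def_a.
have [r [_ br]] := phi_value_odd def_b.
have ef : e = f.
  have [i ai] := phi_value_nonperm def_a.
  have [j bj] := phi_value_nonperm def_b.
  have eb : e * f = f by rewrite -ai -bj -fix_b -endoM mul_trans_const.
  rewrite -eb -ai -bj -[b _]fix_a -endoM mul_const_trans ai.
  by rewrite (endo_phiE def_a) phi_nonperm ?const_nonperm.
have t2u2 : t ^+ 2 = u ^+ 2.
  rewrite -(phi_one def_a) -(phi_one def_b).
  transitivity (a 1 * b 1); first by rewrite -{2}[a 1]fix_b -endoM mulg1 fix_b.
  by rewrite -{1}[b 1]fix_a -endoM mul1g fix_a.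
suff tu : t = u by apply/val_inj; rewrite def_a def_b ef tu.
have uu : [\/ u = t, u = t ^+ 2 | u = e].
  by have := phi_cases def_a (b r); rewrite fix_a br.
have tt : [\/ t = u, t = u ^+ 2 | t = f].
  by have := phi_cases def_b (a s); rewrite fix_b as_.
have ee := phi_e_idem def_a.
case: tt => [//|t_sqr|t_f]; case: uu => [//|u_sqr|u_e].
- by rewrite t_sqr -t2u2 -u_sqr.
- by rewrite t_sqr u_e expg2 ee.
- by rewrite u_sqr t_f -ef expg2 ee.
- by rewrite t_f u_e ef.
Qed.

Lemma no_idem_right_unit a eta : a \notin nonid_idem -> eta \in idempotents n ->
  (a * eta == a) = (eta == 1).
Proof.
move=> nEa idem_eta; apply/eqP/eqP => [fix_a | ->]; last exact: mulg1.
apply/eqP; apply: contraNT nEa => eta_n1.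
apply: (fixed_nonid_idem _ _ fix_a); first exact: fixed_noninj eta_n1 fix_a.
by apply: nonid_idem_noninj; rewrite nonid_idemE idem_eta.
Qed.

(** A non-identity idempotent is a right unit of itself, but of no element
    outside [nonid_idem]; so the two kinds are never related. *)
Lemma LtildeE a b :
  Ltilde a b = (a == b) || (a \notin nonid_idem) && (b \notin nonid_idem).
Proof.
apply/idP/idP.
  move/forall_inP=> Lab; have [//|neq_ab] := eqVneq a b.
  have idem c : c \in nonid_idem -> c \in idempotents n.
    by rewrite nonid_idemE => /andP[].
  have [Ea|nEa] := boolP (a \in nonid_idem);
    have [Eb|nEb] := boolP (b \in nonid_idem) => //=.
  - case/eqP: neq_ab; apply: nonid_idem_fix_eq => //.
    + by apply/eqP; rewrite (eqP (Lab b (idem b Eb))) nonid_idem_mulgg.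
    + by apply/eqP; rewrite -(eqP (Lab a (idem a Ea))) nonid_idem_mulgg.
  - have := eqP (Lab a (idem a Ea)).
    by rewrite nonid_idem_mulgg // eqxx no_idem_right_unit ?idem //
       (negbTE (nonid_idem_n1 Ea)).
  - have := eqP (Lab b (idem b Eb)).
    by rewrite nonid_idem_mulgg // eqxx no_idem_right_unit ?idem //
       (negbTE (nonid_idem_n1 Eb)).
case/orP=> [/eqP-> | /andP[nEa nEb]]; apply/forall_inP=> // eta idem_eta.
by rewrite !no_idem_right_unit.
Qed.

Lemma mem_Ltilde_class a :
  [set b in [set: endo n] | Ltilde a b]
    = if a \in nonid_idem then [set a] else ~: nonid_idem.
Proof.
apply/setP=> b; rewrite !inE LtildeE /=; case: ifP => Ea; rewrite /= !inE.
  by rewrite Ea orbF eq_sym.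
by case: eqP => [<-|] //=; rewrite -?[_ || _]/(a \in nonid_idem) ?Ea.
Qed.

End EndomorphismsOfTn.

Theorem proposition6p6 (n : nat) (hn : 5 <= n) :
  Ltilde_classes n =
    (~: (E3 n :|: E2 n :|: E1 n))
      |: [set [set eta] | eta in [set eta in idempotents n | eta != 1%g]].
Proof.
have classE := mem_Ltilde_class hn; rewrite -/(nonid_idem n).
have mem_nonid eta :
  (eta \in [set eta in idempotents n | eta != 1%g]) = (eta \in nonid_idem n).
  by rewrite inE (nonid_idemE hn).
apply/setP=> X; rewrite in_setU1; apply/imsetP/orP.
  case=> a _ ->; rewrite classE; case: ifP => Ea; last by left.
  by right; apply/imsetP; exists a; rewrite ?mem_nonid.
case=> [/eqP->|/imsetP[a]].
  exists 1%g; rewrite ?inE // classE; case: ifP => // /(nonid_idem_n1 hn).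
  by rewrite eqxx.
by rewrite mem_nonid => Ea ->; exists a; rewrite ?inE // classE Ea.
Qed.
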